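(* Let $H$ be a complex Hilbert space. In the context of bounded positive, commuting and invertible operators $A,B$ on $H$, the following two properties are equivalent: (a) (subadditivity of the spectrum) $\sigma(A+B)\subset\sigma(A)+\sigma(B)$ for all such $A,B$; (b) (submultiplicativity of the spectrum) $\sigma(AB)\subset\sigma(A)\sigma(B)$ for all such $A,B$.
   Context: A bounded operator $A$ on $H$ is positive if $\langle Ax,x\rangle\geq 0$ for all $x\in H$; $\sigma(A)$ is the spectrum of $A$. Here $\sigma(A)+\sigma(B)=\{\lambda+\mu:\lambda\in\sigma(A),\mu\in\sigma(B)\}$ and $\sigma(A)\sigma(B)=\{\lambda\mu:\lambda\in\sigma(A),\mu\in\sigma(B)\}$. *)

(* Defs.v *)
From mathcomp Require Import all_boot all_order all_algebra sesquilinear.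
From mathcomp Require Import complex.
From mathcomp Require Import boolp classical_sets reals topology normedtype.

Set Implicit Arguments.
Unset Strict Implicit.
Unset Printing Implicit Defensive.

Import Order.TTheory GRing.Theory Num.Theory.
Import numFieldNormedType.Exports.

Local Open Scope classical_set_scope.
Local Open Scope complex_scope.
Local Open Scope ring_scope.

Definition bounded_op (R : realType) (H : normedModType R[i])
    (A : {linear H -> H}) : Prop :=
  exists M : R, forall x, `|A x| <= M%:C * `|x|.

(* The order of [R[i]] is partial: [0 <= z] says that [z] is real and
   nonnegative. *)
Definition positive_op (R : realType) (H : normedModType R[i])
    (dot : {dot H for Num.conj}) (A : {linear H -> H}) : Prop :=
  forall x, 0 <= dot (A x) x.

(* Invertibility in the algebra of bounded operators: the inverse is required
   to be bounded. *)
Definition invertible_op (R : realType) (H : normedModType R[i])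
    (A : {linear H -> H}) : Prop :=
  exists B : {linear H -> H}, [/\ bounded_op B, cancel A B & cancel B A].

Definition spectrum (R : realType) (H : normedModType R[i])
    (A : {linear H -> H}) : set R[i] :=
  [set l | ~ invertible_op (A \- l \*: idfun)].

(* The standing assumptions on the pair of operators. *)
Definition admissible (R : realType) (H : normedModType R[i])
    (dot : {dot H for Num.conj}) (A B : {linear H -> H}) : Prop :=
  [/\ bounded_op A /\ bounded_op B,
      positive_op dot A /\ positive_op dot B,
      A \o B =1 B \o A
    & invertible_op A /\ invertible_op B].

(* Main.v *)
(* Both inclusions hold for every admissible pair. Let [S] be [A + B] or [A B]
   and [l] in its spectrum. Since [S] is self-adjoint, [S - l] is normal, and it
   is not bounded below. Minimizing the quadratic form of [A] on the approximate
   kernel of [T := S - l], which [A] preserves, gives a real [m] and unit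
   vectors [x] with both [A x - m x] and [T x] arbitrarily small. Hence [m] is in the
   spectrum of [A], and [l - m], respectively [l / m], is in that of [B]. *)

Require Import Defs.
From mathcomp Require Import all_boot all_order all_algebra sesquilinear.
From mathcomp Require Import complex.
From mathcomp Require Import boolp classical_sets reals topology normedtype.
From HB Require Import structures.
From mathcomp Require Import sequences ring lra.

Import Order.TTheory GRing.Theory Num.Theory.
Import numFieldNormedType.Exports.

Set Implicit Arguments.
Unset Strict Implicit.
Unset Printing Implicit Defensive.

Local Open Scope classical_set_scope.
Local Open Scope complex_scope.
Local Open Scope ring_scope.

(** * Real inequalities behind the penalized minimization *)

(** Read [a], [n2], [N2] as [<Ax, x>], [|Tx|^2], [|x|^2]. Subtracting the lower bound at penalty [t]
    from near-minimality at penalty [2 * t + 1] leaves [(t + 1) * n2] below [2 * w ^+ 2 * N2]. *)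
Lemma penalty_bound (R : realFieldType) (s m w t a N2 n2 : R) :
  0 <= t -> 0 <= n2 -> m - w ^+ 2 <= s ->
  0 <= N2 -> s * N2 <= a + t * n2 ->
  a + (2 * t + 1) * n2 <= (m + w ^+ 2) * N2 ->
  n2 <= 2 * w ^+ 2 * N2 /\ (2 * t + 1) * n2 <= 4 * w ^+ 2 * N2.
Proof.
move=> t0 n0 sm N0 sN aN.
have tn : (t + 1) * n2 <= 2 * w ^+ 2 * N2.
  have : (m - w ^+ 2) * N2 <= s * N2 by rewrite ler_wpM2r.
  lra.
have tn0 : 0 <= t * n2 by rewrite mulr_ge0.
split; lra.
Qed.

(** The last hypothesis expands the positivity of [F u v = <(A - s)u, v> + t <Tu, Tv>] at [x - w y],
    the cross term being [Y2 + t * (aT - s * n2)]. After division by [w], what bounds [Y2] is of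
    order [w * N2]. *)
Lemma discriminant_bound (R : realFieldType)
    (s m w t K K1 C ax ay aT N2 n2 Y2 Ty2 : R) :
  0 <= s -> s <= K -> m - w ^+ 2 <= s -> 0 <= t -> 0 < w -> w <= 1 ->
  0 <= K1 -> 0 <= aT -> 0 <= n2 -> 0 <= N2 -> 0 <= Y2 ->
  ax + t * n2 <= (m + w ^+ 2) * N2 -> t * n2 <= 4 * w ^+ 2 * N2 ->
  ay <= K1 * Y2 -> Y2 <= C ^+ 2 * N2 -> Ty2 <= C ^+ 2 * n2 ->
  2 * w * (Y2 + t * (aT - s * n2)) <=
    ax - s * N2 + t * n2 + w ^+ 2 * (ay - s * Y2 + t * Ty2) ->
  Y2 <= w * (4 * K + 1 + C ^+ 2 * (K1 + 4)) * N2.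
Proof.
move=> s0 sK sm t0 w0 w1 K10 aT0 n0 N0 Y0 axN tnN ayY YN Tyn CS.
have h1 : ax - s * N2 + t * n2 <= 2 * w ^+ 2 * N2.
  have : (m - w ^+ 2) * N2 <= s * N2 by rewrite ler_wpM2r.
  lra.
have h2 : w ^+ 2 * (ay - s * Y2 + t * Ty2) <=
    w ^+ 2 * (C ^+ 2 * (K1 + 4) * N2).
  rewrite ler_wpM2l ?sqr_ge0//.
  have g1 : K1 * Y2 <= K1 * (C ^+ 2 * N2) by rewrite ler_wpM2l.
  have g2 : 0 <= s * Y2 by rewrite mulr_ge0.
  have g3 : t * Ty2 <= C ^+ 2 * (t * n2) by rewrite [leRHS]mulrCA ler_wpM2l.
  have g4 : C ^+ 2 * (t * n2) <= C ^+ 2 * (4 * N2).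
    rewrite ler_wpM2l ?sqr_ge0// (le_trans tnN)// ler_wpM2r//.
    by rewrite ler_piMr// expr_le1// ltW.
  lra.
have h3 : w * s * (t * n2) <= 4 * K * w ^+ 2 * N2.
  have g1 : w * s <= K by rewrite -[K]mul1r ler_pM ?(ltW w0).
  have g2 : 0 <= t * n2 by rewrite mulr_ge0.
  have := le_trans (ler_wpM2r g2 g1) (ler_wpM2l (le_trans s0 sK) tnN); lra.
have h4 : 0 <= w * (t * aT) by rewrite !mulr_ge0// ltW.
have h5 : 0 <= w ^+ 2 * (C ^+ 2 * (K1 + 4) * N2).
  by rewrite mulr_ge0 ?sqr_ge0// mulr_ge0// mulr_ge0 ?sqr_ge0// addr_ge0.
rewrite -(ler_pM2l w0); lra.
Qed.

(** * Real-valued norm, bounded and invertible operators *)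

(** Norms live in the partially ordered [R[i]]; the real part carries them to the total order of
    [R]. *)
Definition rnorm (R : realType) (H : normedModType R[i]) (x : H) : R :=
  complex.Re `|x|.


Section RealNorm.
Variables (R : realType) (H : normedModType R[i]).
Implicit Types (x y : H).

Lemma rnormE x : `|x| = (rnorm x)%:C.
Proof. by rewrite /rnorm RRe_real// ger0_real. Qed.

Lemma rnorm_ge0 x : 0 <= rnorm x.
Proof. by rewrite -ler0c -rnormE. Qed.

Lemma rnorm_eq0 x : rnorm x = 0 -> x = 0.
Proof. by move=> x0; apply/normr0_eq0; rewrite rnormE x0. Qed.

Lemma rnorm0 : rnorm (0 : H) = 0.
Proof. by rewrite /rnorm normr0. Qed.

Lemma rnormN x : rnorm (- x) = rnorm x.
Proof. by rewrite /rnorm normrN. Qed.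

Lemma rnormD x y : rnorm (x + y) <= rnorm x + rnorm y.
Proof. by rewrite -lecR rmorphD/= -!rnormE ler_normD. Qed.

Lemma rnormB x y : rnorm (x - y) <= rnorm x + rnorm y.
Proof. by rewrite -[rnorm y]rnormN rnormD. Qed.

Lemma rnorm_distC x y : rnorm (x - y) = rnorm (y - x).
Proof. by rewrite -rnormN opprB. Qed.

Lemma rnormZ (c : R[i]) x : rnorm (c *: x) = complex.Re `|c| * rnorm x.
Proof.
apply: (@complexI R); rewrite rmorphM/= RRe_real ?ger0_real//.
by rewrite -!rnormE normrZ.
Qed.

Lemma rnormZr (a : R) x : 0 <= a -> rnorm (a%:C *: x) = a * rnorm x.
Proof. by move=> a0; rewrite rnormZ ger0_norm// ler0c. Qed.

Lemma bounded_opP (A : {linear H -> H}) : bounded_op A <->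
  exists2 M : R, 0 < M & forall x, rnorm (A x) <= M * rnorm x.
Proof.
split=> [[M AM]|[M _ AM]]; last first.
  by exists M => x; rewrite !rnormE -rmorphM lecR.
exists (`|M| + 1) => [|x]; first by rewrite ltr_wpDl.
have := AM x; rewrite !rnormE -rmorphM lecR => /le_trans; apply.
by rewrite ler_wpM2r ?rnorm_ge0// (le_trans (ler_norm M))// lerDl.
Qed.

(** The lower bound gives injectivity, hence linearity of a chosen right inverse, and bounds that
    inverse by [c^-1]. *)
Lemma invertible_opP (A : {linear H -> H}) (c : R) : 0 < c ->
  (forall x, c * rnorm x <= rnorm (A x)) -> (forall y, exists x, A x = y) ->
  invertible_op A.
Proof.
move=> c0 Ac /choice[g gK].
have Ainj : injective A.
  move=> x y Axy; apply/subr0_eq/rnorm_eq0/eqP.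
  have := Ac (x - y); rewrite linearB Axy subrr rnorm0 pmulr_rle0// => xy0.
  by rewrite eq_le xy0 rnorm_ge0.
have glin : linear g.
  by move=> a x y; apply: Ainj; rewrite linearP !gK.
pose G : {linear H -> H} :=
  HB.pack_for {linear H -> H} g (GRing.isLinear.Build _ _ _ _ g glin).
exists G; split=> [|x|]; last by exact: gK.
- apply/bounded_opP; exists c^-1 => [|x]; first by rewrite invr_gt0.
  by rewrite ler_pdivlMl// (le_trans (Ac _))//= gK.
- by apply: Ainj; rewrite /= gK.
Qed.

Lemma invertible_bounded_below (A : {linear H -> H}) : invertible_op A ->
  exists2 c : R, 0 < c & forall x, c * rnorm x <= rnorm (A x).
Proof.
move=> [B [/bounded_opP[M M0 BM] AK _]]; exists M^-1 => [|x].
  by rewrite invr_gt0.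
by rewrite mulrC ler_pdivrMr// mulrC -{1}[x]AK BM.
Qed.

End RealNorm.

(** Banach's fixed point theorem, by iterating [g] from [0]. *)
Lemma contraction_fixpoint (R : realType) (H : completeNormedModType R[i])
    (g : H -> H) (k : R) : 0 < k < 1 ->
  (forall x y, rnorm (g x - g y) <= k * rnorm (x - y)) -> exists x, g x = x.
Proof.
move=> /andP[k0 k1] gk; pose u n := iter n g 0; pose D := rnorm (g 0) / (1 - k).
have D0 : 0 <= D by rewrite divr_ge0 ?rnorm_ge0// subr_ge0 ltW.
have gD : rnorm (g 0) = (1 - k) * D.
  by rewrite mulrC divfK// subr_eq0 gt_eqF.
have u1 n : rnorm (u n.+1 - u n) <= k ^+ n * ((1 - k) * D).
  elim: n => [|n IH]; first by rewrite /= subr0 expr0 mul1r gD.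
  by rewrite (le_trans (gk _ _))// exprS -mulrA ler_pM2l.
(* The factor [1 - k ^+ m] records the partial geometric sum, so that the induction closes. *)
have unm n m : rnorm (u (n + m)%N - u n) <= k ^+ n * D * (1 - k ^+ m).
  elim: m => [|m IH]; first by rewrite addn0 subrr rnorm0 expr0 subrr mulr0.
  rewrite addnS -[_ - _](subrKA (u (n + m)%N)) (le_trans (rnormD _ _))//.
  rewrite (le_trans (lerD (u1 _) IH))// exprD exprS.
  rewrite le_eqVlt; apply/orP; left; apply/eqP; ring.
have unD n m : (n <= m)%N -> rnorm (u m - u n) <= k ^+ n * D.
  move=> /subnKC <-; rewrite (le_trans (unm _ _))// ler_piMr//.
    by rewrite mulr_ge0// exprn_ge0// ltW.
  by rewrite gerBl exprn_ge0// ltW.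
have small (e : R) : 0 < e -> exists n, k ^+ n * D < e.
  move=> e0.
  have : (fun n => D * k ^+ n) @ \oo --> (0 : R).
    by apply: cvg_geometric; rewrite ger0_norm// ltW.
  move=> /cvgrPdist_lt/(_ _ e0)[n _ /(_ n (leqnn n))]/=.
  rewrite sub0r normrN mulrC => ue; exists n.
  by apply: le_lt_trans ue; rewrite ler_norm.
have /cauchy_cvgP/cvg_ex[l ul] : cauchy (u @ \oo).
  (* The radius is an element of [R[i]]; being positive, it is real. *)
  apply: cauchy_exP => e /[dup] e0 /gtr0_real/complex_realP[d de].
  rewrite de in e0 *; have {}e0 : 0 < d by rewrite -ltcR.
  have [n ne] := small _ e0; exists (u n); exists n => // m /= nm.
  rewrite -ball_normE/= rnormE ltcR rnorm_distC.
  exact: le_lt_trans (unD _ _ nm) ne.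
exists l; apply/subr0_eq/rnorm_eq0/eqP; rewrite eq_le rnorm_ge0 andbT.
apply/ler_addgt0Pl => e e0; rewrite addr0.
have e2 : (0 : R[i]) < (e / 2)%:C by rewrite -[0]/(0%:C) ltcR divr_gt0.
have [n _ nul] := (cvgrPdist_lt _ _).1 ul _ e2.
have := nul n (leqnn n); have := nul n.+1 (leqnSn n).
rewrite !rnormE !ltcR => a b.
rewrite -[_ - _](subrKA (u n.+1)) (le_trans (rnormD _ _))//.
rewrite [e]splitr lerD//; last by rewrite rnorm_distC ltW.
rewrite (le_trans (gk _ _))// (le_trans _ (ltW b))//.
by rewrite ler_piMl ?rnorm_ge0// ltW.
Qed.

(** * Self-adjoint operators and approximate eigenvalues *)

Section SelfAdjoint.
Variables (R : realType) (H : completeNormedModType R[i]).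
Variables (dot : {dot H for Num.conj}).
Hypothesis dot_norm : forall x : H, dot x x = `|x| ^+ 2.
Implicit Types (x y z : H) (A B S T : {linear H -> H}).

Definition selfadjoint A := forall x y, dot (A x) y = dot x (A y).

Lemma dotC x y : dot y x = (dot x y)^*.
Proof. by rewrite hermC expr0 mul1r. Qed.

(** The defect [f] is sesquilinear and vanishes on the diagonal because [<Ax, x>] is real;
    polarization at [x, y] and at [i x, y] then kills it. *)
Lemma positive_selfadjoint A : positive_op dot A -> selfadjoint A.
Proof.
move=> A0; pose f x y := dot (A x) y - dot x (A y).
have f0 x : f x x = 0.
  have /CrealP := ger0_real (A0 x); rewrite /f [dot x _]dotC => ->.
  by rewrite subrr.
have fC x y : f x y + f y x = 0.
  rewrite -[0](subrr 0) -{1}[0](subr0 0) -{1}(f0 (x + y)) -{1}(f0 x) -(f0 y).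
  rewrite /f !linearD /= !linearDl; ring.
move=> x y; apply/subr0_eq.
have iJ : Num.conj 'i%C = - 'i%C :> R[i].
  by apply/eqP; rewrite eq_complex /= oppr0 !eqxx.
have := fC x y; have := fC ('i%C *: x) y.
rewrite /f !linearZ /= !linearZl_LR /= iJ -[_ *: _]/(_ * _).
set P := dot (A x) y; set P' := dot x (A y).
set Q := dot (A y) x; set Q' := dot y (A x) => e1 e2.
(* This is [e1] minus [i] times [e2], with a correction that vanishes since [i ^+ 2 = -1]. *)
have : 2 * (P - P') = 0.
  transitivity ((P - P' + (Q - Q')) -
    'i%C * ('i%C * P - 'i%C * P' + (- 'i%C * Q + - 'i%C * - Q')) +
    ('i%C ^+ 2 + 1) * (P - P' - Q + Q')); first by ring.
  by rewrite e1 e2 sqr_i mulr0 subr0 addNr mul0r addr0.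
by move=> /eqP; rewrite mulf_eq0 pnatr_eq0/= => /eqP.
Qed.

Definition rdot x y : R := complex.Re (dot x y).

Lemma rdotC x y : rdot x y = rdot y x.
Proof. by rewrite /rdot dotC; case: (dot y x). Qed.

Lemma rdotBl x y z : rdot (x - y) z = rdot x z - rdot y z.
Proof. by rewrite /rdot linearBl raddfB. Qed.

Lemma rdotZl (a : R) x y : rdot (a%:C *: x) y = a * rdot x y.
Proof.
by rewrite /rdot linearZl_LR /=; case: (dot x y) => u v /=; rewrite mul0r subr0.
Qed.

Lemma rdotBr x y z : rdot x (y - z) = rdot x y - rdot x z.
Proof. by rewrite rdotC rdotBl ![rdot _ x]rdotC. Qed.

Lemma rdotZr (a : R) x y : rdot x (a%:C *: y) = a * rdot x y.
Proof. by rewrite rdotC rdotZl rdotC. Qed.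

Lemma rdot_norm x : rdot x x = rnorm x ^+ 2.
Proof. by rewrite /rdot dot_norm rnormE -rmorphXn. Qed.

Lemma rnormB_sqr x y :
  rnorm (x - y) ^+ 2 = rnorm x ^+ 2 - 2 * rdot x y + rnorm y ^+ 2.
Proof. rewrite -!rdot_norm rdotBl !rdotBr (rdotC y x); ring. Qed.

Lemma rdot_le x y : 2 * rdot x y <= rnorm x ^+ 2 + rnorm y ^+ 2.
Proof. have := sqr_ge0 (rnorm (x - y)); rewrite rnormB_sqr; lra. Qed.

Lemma selfadjoint_rdot A x y : selfadjoint A -> rdot (A x) y = rdot x (A y).
Proof. by rewrite /rdot => ->. Qed.

Lemma rnormBZ_sqr (w : R) x y : rnorm (x - w%:C *: y) ^+ 2 =
  rnorm x ^+ 2 - 2 * w * rdot x y + w ^+ 2 * rnorm y ^+ 2.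
Proof.
rewrite rnormB_sqr rdotZr -(rdot_norm (_ *: _)) rdotZl rdotZr rdot_norm; ring.
Qed.

Lemma rdotBZ_sqr A (w : R) x y : selfadjoint A ->
  rdot (A (x - w%:C *: y)) (x - w%:C *: y) =
  rdot (A x) x - 2 * w * rdot (A x) y + w ^+ 2 * rdot (A y) y.
Proof.
move=> Aa; rewrite (linearB A) [A (_ *: _)]linearZ /= !rdotBl !rdotBr.
rewrite !rdotZl !rdotZr (selfadjoint_rdot y x Aa) (rdotC y (A x)); ring.
Qed.

Lemma positive_rdot A x : positive_op dot A -> 0 <= rdot (A x) x.
Proof. by move=> /(_ x); rewrite lecE => /andP[]. Qed.

(* Lax-Milgram: for small [s > 0] the map [x |-> x - s (T x - y)] is a
   contraction. *)
Lemma coercive_surjective T (c : R) : bounded_op T -> 0 < c ->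
  (forall x, c * rnorm x ^+ 2 <= rdot (T x) x) ->
  forall y, exists x, T x = y.
Proof.
(* Adding [c] to the bound forces [c < M], whence [d < 1]. *)
move=> /bounded_opP[M0 M00 TM0] c0 Tc y; pose M := M0 + c.
have M1 : 0 < M by rewrite addr_gt0.
have TM x : rnorm (T x) <= M * rnorm x.
  by rewrite (le_trans (TM0 x))// ler_wpM2r ?rnorm_ge0// lerDl ltW.
(* This [s] minimizes [1 - 2 s c + s^2 M^2], which bounds the squared Lipschitz constant; the
   minimum [1 - 2 d] is at most [(1 - d)^2]. *)
pose s := c / M ^+ 2; have s0 : 0 < s by rewrite divr_gt0// exprn_gt0.
pose d := c ^+ 2 / (2 * M ^+ 2).
have d0 : 0 < d by rewrite divr_gt0// ?mulr_gt0// exprn_gt0.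
have d1 : d < 1.
  rewrite ltr_pdivrMr ?mulr_gt0// ?exprn_gt0// /M; nra.
have [x xE] : exists x, x - s%:C *: (T x - y) = x.
  apply: (@contraction_fixpoint _ _ _ (1 - d)) => [|x x']; first lra.
  have -> : x - s%:C *: (T x - y) - (x' - s%:C *: (T x' - y)) =
            (x - x') - s%:C *: T (x - x').
    rewrite [- (x' - _)]opprD opprK addrACA; congr (_ + _).
    by rewrite addrC -scalerBr -[RHS]scalerN (linearB T) !opprB subrKA.
  move: (x - x') => z.
  rewrite -(ler_pXn2r (ltn0Sn 1)) ?nnegrE ?mulr_ge0 ?rnorm_ge0//; last lra.
  rewrite rnormB_sqr rdotZr rdotC exprMn rnormZr ?(ltW s0)// exprMn.
  have hM : s * rnorm (T z) ^+ 2 <= c * rnorm z ^+ 2.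
    rewrite /s mulrAC ler_pdivrMr ?exprn_gt0// -mulrA ler_pM2l//.
    rewrite -exprMn [_ * M]mulrC.
    by rewrite ler_pXn2r ?nnegrE ?mulr_ge0 ?rnorm_ge0 ?(ltW M1).
  have sd : s * c = 2 * d by rewrite /s /d; field; rewrite gt_eqF.
  have := Tc z; have := sqr_ge0 (rnorm z); nra.
exists x; apply/subr0_eq.
have : s%:C *: (T x - y) = 0 by rewrite -[LHS](subKr x) xE subrr.
move=> /eqP; rewrite scaler_eq0 -[0]/(0%:C) => /orP[|/eqP//].
by move=> /eqP/complexI s00; rewrite s00 ltxx in s0.
Qed.


Lemma bounded_op_shift S (l : R[i]) :
  bounded_op S -> bounded_op (S \- l \*: idfun).
Proof.
move=> /bounded_opP[M M0 SM]; apply/bounded_opP.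
have l0 : 0 <= complex.Re `|l| by rewrite -ler0c RRe_real// ger0_real.
exists (M + complex.Re `|l|) => [|x]; first by rewrite ltr_wpDr.
by rewrite /= (le_trans (rnormB _ _))// mulrDl rnormZ lerD2r.
Qed.

Lemma bounded_op_comp S T : bounded_op S -> bounded_op T -> bounded_op (S \o T).
Proof.
move=> /bounded_opP[M M0 SM] /bounded_opP[K K0 TK]; apply/bounded_opP.
exists (M * K) => [|x]; first by rewrite mulr_gt0.
by rewrite (le_trans (SM _))// -mulrA ler_pM2l.
Qed.

(* [S - l] is normal, so if it is bounded below then its product with its
   adjoint is coercive, which makes [S - l] onto. *)
Lemma spectrum_approx_eigen S (l : R[i]) : bounded_op S -> selfadjoint S ->
  spectrum S l -> forall c : R, 0 < c ->
  exists x, rnorm (S x - l *: x) < c * rnorm x.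
Proof.
move=> Sb Sa lS c c0; apply: contrapT => /forallNP nx; apply: lS.
have {}nx x : c * rnorm x <= rnorm (S x - l *: x).
  by rewrite leNgt; apply/negP/nx.
pose T : {linear H -> H} := S \- l \*: idfun.
pose T' : {linear H -> H} := S \- l^*%C \*: idfun.
have TT' x y : dot (T x) y = dot x (T' y).
  rewrite /T /T' /= linearBl linearBr. congr (_ - _); first exact: Sa.
  rewrite linearZl_LR linearZr_LR /=.
  by rewrite -[RHS]/(conjc (conjc l) * dot x y) conjcK.
have TC x : T (T' x) = T' (T x).
  rewrite /T /T' /= !linearB /= !linearZ /=.
  by rewrite !scalerA [_ * l]mulrC addrACA.
apply: (@invertible_opP _ _ T c c0) => [//|y].
suff [x xy] : exists x, (T \o T') x = y by exists (T' x).
apply: (@coercive_surjective _ (c ^+ 2)); last 1 first.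
- move=> x.
  have -> : rdot ((T \o T') x) x = rnorm (T x) ^+ 2.
    by rewrite rdotC -rdot_norm -[(T \o T') x]/(T (T' x)) TC /rdot -TT'.
  by rewrite -exprMn ler_pXn2r ?nnegrE ?mulr_ge0 ?rnorm_ge0 ?(ltW c0)//;
     exact: nx.
- by apply: bounded_op_comp; exact: bounded_op_shift.
- by rewrite exprn_gt0.
Qed.

(** A bounded inverse would keep [|S x - l x|] above a fixed positive multiple of [|x|]. *)
Lemma approx_eigen_spectrum S (l : R[i]) :
  (forall c : R, 0 < c ->
    exists2 x, 0 < rnorm x & rnorm (S x - l *: x) <= c * rnorm x) ->
  spectrum S l.
Proof.
move=> Sl /invertible_bounded_below[c c0 cS].
have [|x x0 xc] := Sl (c / 2); first by rewrite divr_gt0.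
have := cS x => /= {}cS; have := le_trans cS xc; nra.
Qed.

End SelfAdjoint.

(** * Joint approximate eigenvectors *)

(* [m] is the supremum of the [s] for which some form
   [F u v := <(A - s) u, v> + t <T u, T v>] is positive. A near-minimizer [x] of
   [F x x], for a [t] twice as large, makes [T x] small; then
   [F (x - w y) (x - w y) >= 0] with [y := (A - s) x] bounds [|y|^2], because
   [T y = (A - s) T x] keeps [t |T y|^2] bounded however large [t] is. *)
Lemma joint_approx_eigen (R : realType) (H : completeNormedModType R[i])
    (dot : {dot H for Num.conj}) (A T : {linear H -> H}) :
  (forall x : H, dot x x = `|x| ^+ 2) -> bounded_op A -> positive_op dot A ->
  A \o T =1 T \o A ->
  (forall c : R, 0 < c -> exists x, rnorm (T x) < c * rnorm x) ->
  exists m : R, forall e : R, 0 < e -> exists x,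
    [/\ 0 < rnorm x, rnorm (A x - m%:C *: x) <= e * rnorm x
      & rnorm (T x) <= e * rnorm x].
Proof.
move=> dot_norm /bounded_opP[M M0 AM] A0 AT Tker.
have Asym := positive_selfadjoint A0.
have a0 x := positive_rdot x A0.
pose K1 := (M ^+ 2 + 1) / 2.
have K10 : 0 < K1 by rewrite divr_gt0// ltr_wpDl// sqr_ge0.
have aK x : rdot dot (A x) x <= K1 * rnorm x ^+ 2.
  have := rdot_le dot_norm (A x) x.
  have : rnorm (A x) ^+ 2 <= M ^+ 2 * rnorm x ^+ 2.
    rewrite -exprMn ler_pXn2r ?nnegrE ?mulr_ge0 ?rnorm_ge0 ?(ltW M0)//.
  rewrite /K1; lra.
pose q t x := rdot dot (A x) x + t * rnorm (T x) ^+ 2.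
pose E : set R := [set s | 0 <= s /\
  exists2 t, 0 <= t & forall x, s * rnorm x ^+ 2 <= q t x].
(* The extra [1] absorbs [t |Tx|^2], which is at most [|x|^2] once [|Tx| < |x| / (1 + t)]. *)
pose K := K1 + 1.
have E0 : E 0.
  split=> //; exists 0 => // x; rewrite /q !mul0r addr0; exact: a0.
have EK : ubound E K.
  move=> s [s0 [t t0 st]].
  have t10 : 0 < 1 + t by rewrite ltr_wpDr.
  have [|x] := Tker (1 + t)^-1; first by rewrite invr_gt0.
  rewrite mulrC ltr_pdivlMr// => xT.
  have x0 : 0 < rnorm x.
    by apply: le_lt_trans xT; rewrite mulr_ge0 ?rnorm_ge0// ltW.
  have Tx0 := rnorm_ge0 (T x).
  have xT2 : t * rnorm (T x) ^+ 2 <= rnorm x ^+ 2.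
    have : (rnorm (T x) * (1 + t)) ^+ 2 <= rnorm x ^+ 2.
      by rewrite ler_pXn2r ?nnegrE ?mulr_ge0 ?rnorm_ge0 ?(ltW t10) ?(ltW xT).
    apply: le_trans; rewrite exprMn mulrC ler_wpM2l ?sqr_ge0//; nra.
  have := st x; have := aK x; rewrite /q => h1 h2.
  have x20 : 0 < rnorm x ^+ 2 by rewrite exprn_gt0.
  rewrite -(ler_pM2r x20) /K mulrDl; lra.
have Esup : has_sup E by split; [exists 0 | exists K].
pose m := sup E.
have m0 : 0 <= m by apply: ub_le_sup => //; exists K.
have mK : m <= K by apply: ge_sup => //; exists 0.
have K0 : 0 < K by rewrite /K addr_gt0.
(* [C] bounds [A - s] for [0 <= s <= K]; it serves for [y = (A - s) x] and for
   [T y = (A - s) T x]. *)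
pose C := M + K.
have C0 : 0 < C by rewrite /C addr_gt0.
pose D := 4 * K + 1 + C ^+ 2 * (K1 + 4).
have D0 : 0 < D.
  by rewrite /D !addr_gt0 ?mulr_gt0 ?exprn_gt0 ?addr_gt0.
exists m => e e0.
(* The bound on [w * D] will give [|y| <= e / 2 * |x|]; the others give [w ^+ 2 <= e / 2], which
   dominates [m - s], and [2 * w ^+ 2 <= e ^+ 2], which controls [|Tx|]. *)
have [w [w0 w1 we wD]] :
    exists w : R, [/\ 0 < w, w <= 1, w <= e / 2 & w * D <= (e / 2) ^+ 2].
  exists (Num.min 1 (Num.min (e / 2) ((e / 2) ^+ 2 / D))).
  rewrite !lt_min !ge_min ltr01 !divr_gt0 ?exprn_gt0 ?lexx ?orbT ?divr_gt0//.
  split=> //; rewrite -ler_pdivlMr// !ge_min lexx !orbT//.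
have w20 : 0 < w ^+ 2 by rewrite exprn_gt0.
have [s [s0 [t t0 st]] sm] := sup_adherent w20 Esup.
have {}sm : m - w ^+ 2 < s by [].
have sm' : s <= m by apply: ub_le_sup; [exists K | split=> //; exists t].
(* Otherwise [m + w ^+ 2] would lie in [E], above its supremum. The penalty exceeds [t] by [t + 1],
   at least [1] and at least half of [2 * t + 1], so both [|Tx|^2] and its penalized value stay
   small. *)
have [x xq] : exists x, q (2 * t + 1) x < (m + w ^+ 2) * rnorm x ^+ 2.
  apply: contrapT => /forallNP nx.
  have Em : E (m + w ^+ 2).
    split; first by rewrite addr_ge0// ltW.
    exists (2 * t + 1) => [|x]; first lra.
    by rewrite leNgt; apply/negP/nx.
  have /= := ub_le_sup (ex_intro _ K EK : has_ubound E) Em; rewrite -/m; lra.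
have q0 : 0 <= q (2 * t + 1) x.
  by rewrite /q addr_ge0 ?a0// mulr_ge0 ?sqr_ge0// addr_ge0 ?mulr_ge0.
have x0 : 0 < rnorm x.
  rewrite lt_neqAle rnorm_ge0 andbT; apply/eqP => x0.
  by move: xq; rewrite -x0 expr0n mulr0 ltNge q0.
set N := rnorm x in x0 xq *; set n := rnorm (T x) in xq q0 *.
have n0 : 0 <= n by exact: rnorm_ge0.
pose y := A x - s%:C *: x; set Y := rnorm y.
have Y0 : 0 <= Y by exact: rnorm_ge0.
have shiftC z : rnorm (A z - s%:C *: z) <= C * rnorm z.
  rewrite (le_trans (rnormB _ _))// rnormZr// /C mulrDl lerD//.
  rewrite ler_wpM2r ?rnorm_ge0//.
  exact: le_trans sm' mK.
have Ty : T y = A (T x) - s%:C *: T x.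
  by have /= ATx := AT x; rewrite /y linearB linearZ ATx.
have YC : Y <= C * N := shiftC x.
have TyC : rnorm (T y) <= C * n by rewrite Ty; exact: shiftC.
have stx := st x; rewrite /q -/n -/N in stx xq.
have [n2 t1n] :=
  penalty_bound t0 (sqr_ge0 n) (ltW sm) (sqr_ge0 N) stx (ltW xq).
have Yle : Y ^+ 2 <= w * D * N ^+ 2.
  (* Raising the penalty from [t] to [2 * t + 1] only increases the form. *)
  have CS : s * rnorm (x - w%:C *: y) ^+ 2 <= q (2 * t + 1) (x - w%:C *: y).
    apply: (le_trans (st _)); rewrite /q lerD2l ler_wpM2r ?sqr_ge0//.
    by move: t0; clear; lra.
  have rY : Y ^+ 2 = rdot dot (A x) y - s * rdot dot x y.
    by rewrite -(rdot_norm dot_norm) {1}/y rdotBl rdotZl.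
  have rT : rdot dot (T x) (T y) = rdot dot (A (T x)) (T x) - s * n ^+ 2.
    rewrite Ty rdotBr rdotZr (rdot_norm dot_norm).
    by rewrite (selfadjoint_rdot _ _ Asym).
  have Tz : T (x - w%:C *: y) = T x - w%:C *: T y.
    by rewrite (linearB T) [T (_ *: _)]linearZ.
  rewrite /q Tz (rnormBZ_sqr dot_norm w x y) in CS.
  rewrite (rnormBZ_sqr dot_norm w (T x) (T y)) (rdotBZ_sqr w x y Asym) rT in CS.
  apply: (discriminant_bound (C := C) (ax := rdot dot (A x) x)
    (t := 2 * t + 1) (Ty2 := rnorm (T y) ^+ 2) s0 (le_trans sm' mK) (ltW sm)
    _ w0 w1 (ltW K10) (a0 (T x)) (sqr_ge0 n) (sqr_ge0 N) (sqr_ge0 Y) (ltW xq)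
    t1n (aK y)) => //.
  - by rewrite addr_ge0 ?mulr_ge0.
  - by rewrite -exprMn ler_pXn2r ?nnegrE ?mulr_ge0 ?(ltW C0) ?(ltW x0).
  - by rewrite -exprMn ler_pXn2r ?nnegrE ?mulr_ge0 ?(ltW C0) ?rnorm_ge0.
  - move: CS; rewrite rY; clear; lra.
have Ye : Y <= e / 2 * N.
  rewrite -(ler_pXn2r (ltn0Sn 1)) ?nnegrE ?mulr_ge0 ?invr_ge0 ?(ltW e0)
    ?(ltW x0)//.
  by rewrite (le_trans Yle)// exprMn ler_wpM2r ?sqr_ge0.
exists x; split=> //.
(* Half of [e] pays for [y], the other half for replacing [s] by [m]. *)
- have -> : A x - m%:C *: x = y - (m - s)%:C *: x.
    by rewrite /y rmorphB/= scalerBl opprB addrA subrK.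
  rewrite (le_trans (rnormB _ _))// rnormZr ?subr_ge0// -/Y -/N.
  have : (m - s) * N <= e / 2 * N.
    by rewrite ler_pM2r//; move: w0 w1 we sm; clear; nra.
  by move: Ye; clear; lra.
- rewrite -(ler_pXn2r (ltn0Sn 1)) ?nnegrE ?mulr_ge0 ?rnorm_ge0 ?(ltW e0)//.
  rewrite -/n -/N (le_trans n2)// exprMn ler_wpM2r ?sqr_ge0//.
  by move: w0 w1 we e0; clear; nra.
Qed.

(** * The two spectral inclusions *)

Lemma spectrumD_commuting_positive (R : realType)
    (H : completeNormedModType R[i]) (dot : {dot H for Num.conj})
    (A B : {linear H -> H}) :
  (forall x : H, dot x x = `|x| ^+ 2) -> bounded_op A -> bounded_op B ->
  positive_op dot A -> positive_op dot B -> A \o B =1 B \o A ->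
  spectrum (A \+ B) `<=` [set l + m | l in spectrum A & m in spectrum B].
Proof.
move=> dot_norm Ab Bb A0 B0 AB l lAB.
have Sb : bounded_op (A \+ B).
  case/bounded_opP: Ab => M M0 AM; case/bounded_opP: Bb => K K0 BK.
  apply/bounded_opP; exists (M + K) => [|x]; first by rewrite addr_gt0.
  by rewrite (le_trans (rnormD _ _))// mulrDl lerD.
have S0 : positive_op dot (A \+ B).
  by move=> x; rewrite /= linearDl addr_ge0//; [exact: A0|exact: B0].
pose T : {linear H -> H} := (A \+ B) \- l \*: idfun.
have AT : A \o T =1 T \o A.
  move=> x; rewrite /T /= linearB linearD linearZ /=.
  by rewrite -[B (A x)]/((B \o A) x) -AB.
have [m mP] := joint_approx_eigen dot_norm Ab A0 AT
  (spectrum_approx_eigen dot_norm Sb (positive_selfadjoint S0) lAB).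
exists m%:C; last exists (l - m%:C); last by rewrite addrC subrK.
- apply: approx_eigen_spectrum => c c0; have [x [x0 Ax _]] := mP _ c0.
  by exists x.
- apply: approx_eigen_spectrum => c c0.
  have [x [x0 Ax Tx]] := mP _ (divr_gt0 c0 (ltr0n R 2)); exists x => //.
  (* Both terms on the right are errors of size at most [c / 2 * |x|]. *)
  have -> : B x - (l - m%:C) *: x = T x - (A x - m%:C *: x).
    rewrite /T /= scalerBl !opprB -!addrA [A x + _]addrC.
    by rewrite -!addrA addNr addr0 addrA addrA addrAC.
  rewrite (le_trans (rnormB _ _))// [c]splitr mulrDl lerD//.
Qed.

Lemma spectrumM_commuting_positive (R : realType)
    (H : completeNormedModType R[i]) (dot : {dot H for Num.conj})
    (A B : {linear H -> H}) :
  (forall x : H, dot x x = `|x| ^+ 2) -> bounded_op A -> bounded_op B ->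
  positive_op dot A -> positive_op dot B -> A \o B =1 B \o A ->
  invertible_op A ->
  spectrum (A \o B) `<=` [set l * m | l in spectrum A & m in spectrum B].
Proof.
move=> dot_norm Ab Bb A0 B0 AB Ai l lAB.
have Sa : selfadjoint dot (A \o B).
  move=> x y /=; rewrite (positive_selfadjoint A0) (positive_selfadjoint B0).
  by rewrite -[B (A y)]/((B \o A) y) -AB.
pose T : {linear H -> H} := (A \o B) \- l \*: idfun.
have AT : A \o T =1 T \o A.
  by move=> x; rewrite /T /= linearB linearZ /= -[B (A x)]/((B \o A) x) -AB.
have [m mP] := joint_approx_eigen dot_norm Ab A0 AT
  (spectrum_approx_eigen dot_norm (bounded_op_comp Ab Bb) Sa lAB).
(* If [m] were [0], the vectors [x] would contradict the lower bound of the invertible [A]. *)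
have m0 : m%:C != 0.
  apply/eqP => m0; have [c c0 cA] := invertible_bounded_below Ai.
  have [x [x0 Ax _]] := mP _ (divr_gt0 c0 (ltr0n R 2)).
  move: Ax (cA x); rewrite m0 scale0r subr0; move: x0 c0; clear; nra.
exists m%:C; last exists (l / m%:C); last by rewrite mulrC divfK.
- apply: approx_eigen_spectrum => c c0; have [x [x0 Ax _]] := mP _ c0.
  by exists x.
- apply: approx_eigen_spectrum => c c0.
  case/bounded_opP: Bb => M M0 BM.
  have m_gt0 : 0 < complex.Re `|m%:C|.
    by rewrite -ltcR RRe_real ?normr_gt0// ger0_real.
  have M10 : 0 < 1 + M by rewrite addr_gt0.
  (* The tolerance is [c |m| / (1 + M)]: multiplied by [m], the error in [B x] is that of [T x] plus
     at most [M] times that of [A x], so [1 + M] tolerances in all. *)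
  have [x [x0 Ax Tx]] :=
    mP _ (divr_gt0 (mulr_gt0 c0 m_gt0) M10); exists x => //.
  set e := _ / _ in Ax Tx.
  rewrite -(ler_pM2l m_gt0) -rnormZ scalerBr scalerA [m%:C * _]mulrC divfK//.
  have -> : m%:C *: B x - l *: x = T x - B (A x - m%:C *: x).
    rewrite /T /= (linearB B) [B (_ *: _)]linearZ /=.
    rewrite -[B (A x)]/((B \o A) x) -AB /=.
    by rewrite opprB [RHS]addrC subrKA.
  rewrite (le_trans (rnormB _ _))// (le_trans (lerD Tx (BM _)))//.
  rewrite (le_trans (lerD (lexx _) (ler_wpM2l (ltW M0) Ax)))//.
  rewrite le_eqVlt; apply/orP; left; apply/eqP; rewrite /e; field.
  by rewrite gt_eqF.
Qed.

Unset Implicit Arguments.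

Theorem proposition2p21 (R : realType) (H : completeNormedModType R[i])
    (dot : {dot H for Num.conj})
    (dot_norm : forall x : H, dot x x = `|x| ^+ 2) :
  (forall A B : {linear H -> H}, admissible dot A B ->
     spectrum (A \+ B) `<=` [set l + m | l in spectrum A & m in spectrum B])
  <->
  (forall A B : {linear H -> H}, admissible dot A B ->
     spectrum (A \o B) `<=` [set l * m | l in spectrum A & m in spectrum B]).
Proof.
split=> _ A B [[Ab Bb] [A0 B0] AB [Ai _]].
- exact: (spectrumM_commuting_positive dot_norm).
- exact: (spectrumD_commuting_positive dot_norm).
Qed.
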